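(* Let $(X,Y)$ be a random pair with values in $\mathcal X\times\mathbb R$ and let $x\in\mathcal X$. Let $V:\mathcal X\times\mathbb R\to\mathbb R$ be one of the following non-conformity scores: (i) $V(x,y)=|y-f(x)|$; (ii) $V(x,y)=|y-f(x)|/\sigma(x)$; (iii) $V(x,y)=\max\{\hat f_{\alpha_{\mathrm{lo}}}(x)-y,\ y-\hat f_{\alpha_{\mathrm{hi}}}(x)\}$, where $f,\hat f_{\alpha_{\mathrm{lo}}},\hat f_{\alpha_{\mathrm{hi}}}:\mathcal X\to\mathbb R$ and $\sigma:\mathcal X\to(0,\infty)$ are fixed measurable functions. Let $P_\phi(Y\mid X=x)$ be any probability distribution on $\mathbb R$ (a model for the conditional law of $Y$ given $X=x$). Then $$\mathrm{KS}\big(P(V\mid X=x),P(V)\big)\le 2\,\mathrm{KS}\big(P(Y\mid X=x),P_\phi(Y\mid X=x)\big)+\mathrm{KS}\big(P_\phi(V\mid X=x),P(V)\big).$$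
   Context: For two probability distributions $P,Q$ on $\mathbb R$ with cumulative distribution functions $F_P,F_Q$, the Kolmogorov–Smirnov distance is $\mathrm{KS}(P,Q)=\sup_{t\in\mathbb R}|F_P(t)-F_Q(t)|$. $P(V)$ is the (marginal) law of $V(X,Y)$; $P(Y\mid X=x)$ is a fixed regular conditional distribution of $Y$ given $X=x$; $P(V\mid X=x)$ is the law of $V(x,Y')$ with $Y'\sim P(Y\mid X=x)$; $P_\phi(V\mid X=x)$ is the law of $V(x,\hat Y)$ with $\hat Y\sim P_\phi(Y\mid X=x)$. *)

(* Defs.v *)
From HB Require Import structures.
From mathcomp Require Import all_boot all_order all_algebra.
From mathcomp Require Import all_classical all_reals all_analysis.
From mathcomp Require Import measurable_realfun.

Set Implicit Arguments.
Unset Strict Implicit.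
Unset Printing Implicit Defensive.

Import Order.TTheory GRing.Theory Num.Theory.

Local Open Scope classical_set_scope.
Local Open Scope ring_scope.

(* The set of gaps is nonempty and bounded by 1, so the real-valued [sup] is
   the genuine supremum. *)
Definition KS (R : realType) (P Q : probability R R) : R :=
  sup [set `|fine (P `]-oo, t]%classic) - fine (Q `]-oo, t]%classic)|
      | t in [set: R]].

Section random_pair.
Context d d1 d2 (T : measurableType d) (T1 : measurableType d1)
  (T2 : measurableType d2).

Definition pair_fun (X : T -> T1) (Y : T -> T2) : T -> T1 * T2 :=
  fun w => (X w, Y w).

Variables (X : {mfun T >-> T1}) (Y : {mfun T >-> T2}).

HB.instance Definition _ := isMeasurableFun.Build _ _ _ _ (pair_fun X Y)
  (measurable_fun_pair (measurable_funPT X) (measurable_funPT Y)).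

End random_pair.

Section pair_section.
Context d1 d2 (T1 : measurableType d1) (T2 : measurableType d2) (x : T1).

Definition section_fun : T2 -> T1 * T2 := pair x.

HB.instance Definition _ :=
  isMeasurableFun.Build _ _ _ _ section_fun (pair1_measurable x).

End pair_section.

Section kernel_at.
Context d d' (T : measurableType d) (T' : measurableType d') (R : realType).
Variables (k : R.-pker T ~> T') (x : T).

(* [k x] is registered in the library as a measure only; this packages it as a
   probability. *)
Definition kernel_at : set T' -> \bar R := k x.

HB.instance Definition _ := Measure.on kernel_at.
HB.instance Definition _ :=
  Measure_isProbability.Build _ _ _ kernel_at (prob_kernel x).

End kernel_at.

(* [k x] plays the role of the law of [Y] given [X = x]: [k] is a probability
   kernel and, for each measurable [B], [k (X _) B] is a version of the
   conditional probability of [Y \in B] given the sigma-algebra of [X]. *)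
Definition regular_conditional_distribution d d' d'' (Omega : measurableType d)
    (T : measurableType d') (T' : measurableType d'') (R : realType)
    (P : probability Omega R) (X : {RV P >-> T}) (Y : {RV P >-> T'})
    (k : R.-pker T ~> T') : Prop :=
  forall (A : set T) (B : set T'), measurable A -> measurable B ->
    (P (X @^-1` A `&` Y @^-1` B) = \int[P]_(w in X @^-1` A) k (X w) B)%E.

Section scores.
Context d (T : measurableType d) (R : realType).

Inductive score :=
| absolute_residual of {mfun T >-> R}
| scaled_residual (f sigma : {mfun T >-> R}) of (forall x, 0 < sigma x)
| quantile_score (flo fhi : {mfun T >-> R}).

Definition score_fun (s : score) (z : T * R) : R :=
  let: (x, y) := z in
  match s with
  | absolute_residual f => `|y - f x|
  | scaled_residual f sigma _ => `|y - f x| / sigma x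
  | quantile_score flo fhi => Num.max (flo x - y) (y - fhi x)
  end.

Lemma measurable_score_fun (s : score) : measurable_fun setT (score_fun s).
Proof.
have mf (f : {mfun T >-> R}) : measurable_fun setT (fun z : T * R => f z.1).
  by apply: measurableT_comp => //; exact: measurable_fst.
have my : measurable_fun setT (fun z : T * R => z.2) by exact: measurable_snd.
case: s => [f|f sigma sigma_gt0|flo fhi].
- have -> : score_fun (absolute_residual f) = fun z => `|z.2 - f z.1|.
    by apply/funext => -[].
  by apply: measurableT_comp => //; apply: measurable_funB.
- have -> : score_fun (scaled_residual f sigma_gt0) =
            fun z => `|z.2 - f z.1| * (sigma z.1)^-1.
    by apply/funext => -[].
  apply: measurable_funM.
    by apply: measurableT_comp => //; apply: measurable_funB.
  apply: (measurable_comp (F := [set r : R | r != 0])) => //.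
  - by apply: open_measurable; exact: open_neq.
  - by move=> _ [z _ <-] /=; rewrite gt_eqF.
  - apply: open_continuous_measurable_fun; first exact: open_neq.
    by move=> r; rewrite inE /= => r0; exact: inv_continuous.
- have -> : score_fun (quantile_score flo fhi) =
            (fun z => flo z.1 - z.2) \max (fun z => z.2 - fhi z.1).
    by apply/funext => -[].
  by apply: measurable_maxr; apply: measurable_funB.
Qed.

HB.instance Definition _ (s : score) :=
  isMeasurableFun.Build _ _ _ _ (score_fun s) (measurable_score_fun s).

End scores.

Section score_laws.
Context d (T : measurableType d) (R : realType) (V : {mfun (T * R)%type >-> R}).

Definition marginal_law d' (Omega : measurableType d') (P : probability Omega R)
    (X : {RV P >-> T}) (Y : {RV P >-> R}) : probability R R :=
  distribution P (V \o pair_fun X Y).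

(* the law of [V (x, Y')] for [Y'] distributed according to [Q] *)
Definition law_at (x : T) (Q : probability R R) : probability R R :=
  distribution Q (V \o section_fun x).

End score_laws.

(* Main.v *)
Require Import Defs.
From HB Require Import structures.
From mathcomp Require Import all_boot all_order all_algebra.
From mathcomp Require Import all_classical all_reals all_analysis.
From mathcomp Require Import lra.

Import Order.TTheory GRing.Theory Num.Theory.
Import numFieldNormedType.Exports.

Local Open Scope classical_set_scope.
Local Open Scope ring_scope.

(** For every score, the sublevel set [{y | V (x, y) <= t}] is a closed interval
    [[a, b]], possibly empty. When it is nonempty, its probability is
    [F b - F (a-)]; each of the two terms changes by at most [KS P Q] when [P]
    is replaced by [Q], the left limit [F (a-)] being a limit of values of [F].
    This bounds the distance between the two laws of the score by
    [2 * KS P Q], and the triangle inequality concludes. *)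

Section KS_theory.
Context {R : realType}.
Implicit Types P Q S : probability R R.

Lemma cdf_gap_le_KS P Q (t : R) :
  `|fine (P `]-oo, t]%classic) - fine (Q `]-oo, t]%classic)| <= KS P Q.
Proof.
apply: ub_le_sup; last by exists t.
(* Both cumulative values lie in [[0, 1]], so [1] bounds every gap and the supremum is genuine. *)
exists 1 => _ [u _ <-].
have cdf01 (S : probability R R) : 0 <= fine (S `]-oo, u]%classic) <= 1.
  rewrite fine_ge0 //= -lee_fin fineK ?fin_num_measure //.
  exact: probability_le1.
have := cdf01 P; have := cdf01 Q.
by rewrite ler_norml; lra.
Qed.

Lemma KS_le P Q (c : R) :
  (forall t : R,
    `|fine (P `]-oo, t]%classic) - fine (Q `]-oo, t]%classic)| <= c) ->
  KS P Q <= c.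
Proof.
move=> gap_le; apply: ge_sup; last by move=> _ [t _ <-].
by eexists; exists 0.
Qed.

Lemma KS_ge0 P Q : 0 <= KS P Q.
Proof. exact: le_trans (normr_ge0 _) (cdf_gap_le_KS P Q 0). Qed.

Lemma KS_triangle Q P S : KS P S <= KS P Q + KS Q S.
Proof.
apply: KS_le => t; apply: le_trans (ler_distD (fine (Q `]-oo, t]%classic)) _ _) _.
by apply: lerD; exact: cdf_gap_le_KS.
Qed.

(** Continuity from below: the closed half-lines increase to the open one. *)
Lemma cvg_cdf_left P (a : R) :
  fine (P `]-oo, (a - n.+1%:R^-1)]%classic) @[n --> \oo]
    --> fine (P `]-oo, a[%classic).
Proof.
have open_bigcup : `]-oo, a[%classic =
    \bigcup_n `]-oo, (a - n.+1%:R^-1)]%classic.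
  apply/seteqP; split=> [y /=|y [n _]] /=; rewrite !in_itv /=; last first.
    by move=> /le_lt_trans; apply; rewrite ltrBlDr ltrDl invr_gt0.
  (* [y - 1] is an arbitrary left endpoint, since [itv_bnd_open_bigcup] concerns intervals bounded
     on the left. *)
  move=> ya; have : [set` Interval (BSide false (y - 1)) (BLeft a)] y.
    by rewrite /= in_itv /= ya andbT ltrBlDr ltrDl.
  by rewrite itv_bnd_open_bigcup => -[n _ /=]; rewrite in_itv /= => /andP[_ yn];
    exists n => //=; rewrite in_itv.
apply: fine_cvg; rewrite fineK ?fin_num_measure // open_bigcup.
apply: nondecreasing_cvg_mu => //; first exact: bigcup_measurable.
move=> n m nm; apply/subsetPset => y /=; rewrite !in_itv /= => /le_trans; apply.
by rewrite lerB // lef_pV2 ?posrE // ler_nat.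
Qed.

Lemma left_cdf_gap_le_KS P Q (a : R) :
  `|fine (P `]-oo, a[%classic) - fine (Q `]-oo, a[%classic)| <= KS P Q.
Proof.
apply: (cvgr_to_le
  (cvg_norm (cvgB (cvg_cdf_left P a) (cvg_cdf_left Q a)))).
by near=> n; exact: cdf_gap_le_KS.
Unshelve. all: by end_near.
Qed.

(** For [b < a] the right side would be minus the mass of []b, a[], hence the hypothesis. *)
Lemma measure_itvcc P (a b : R) : a <= b ->
  fine (P `[a, b]%classic) =
  fine (P `]-oo, b]%classic) - fine (P `]-oo, a[%classic).
Proof.
move=> ab.
have -> : `]-oo, b]%classic = `]-oo, a[%classic `|` `[a, b]%classic.
  by rewrite -itv_bndbnd_setU // bnd_simp.
rewrite measureU //; last first.
  by rewrite -subset0 => y /=; rewrite !in_itv /=; lra.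
by rewrite fineD ?fin_num_measure // addrC addKr.
Qed.

Lemma itvcc_gap_le_KS P Q (a b : R) :
  `|fine (P `[a, b]%classic) - fine (Q `[a, b]%classic)| <= 2 * KS P Q.
Proof.
have [ab|ba] := leP a b; last first.
  by rewrite set_itv_ge ?bnd_simp -?ltNge // !measure0 subrr normr0
    mulr_ge0 ?KS_ge0.
(* Regroups the four terms by endpoint: the gap at [b] minus the left-limit gap at [a]. *)
rewrite !measure_itvcc // opprD addrACA -opprD mulr_natl mulr2n.
apply: le_trans (ler_normB _ _) _.
by apply: lerD; [exact: cdf_gap_le_KS | exact: left_cdf_gap_le_KS].
Qed.

End KS_theory.

(** Solving each inequality for [y] gives the endpoints. No sign condition on [t] is needed: when
    the endpoints cross, both sides are empty. *)
Lemma score_sublevel {d} {T : measurableType d} {R : realType} (s : score T R)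
    (x : T) (t : R) :
  exists a b : R, [set y | score_fun s (x, y) <= t] = `[a, b]%classic.
Proof.
case: s => [f|f sigma sigma_gt0|flo fhi].
- exists (f x - t), (f x + t); apply/seteqP; split=> y /=;
    by rewrite in_itv /= ler_distl.
- exists (f x - t * sigma x), (f x + t * sigma x); apply/seteqP; split=> y /=;
    by rewrite in_itv /= ler_pdivrMr // ler_distl.
- exists (flo x - t), (fhi x + t); apply/seteqP; split=> y /=;
    by rewrite in_itv /= ge_max !lerBlDr [y + t]addrC [_ + t]addrC.
Qed.

Lemma KS_law_at_le {d} {T : measurableType d} {R : realType} (s : score T R)
    (x : T) (P Q : probability R R) :
  KS (law_at (score_fun s) x P) (law_at (score_fun s) x Q) <= 2 * KS P Q.
Proof.
apply: KS_le => t; have [a [b sublevel]] := score_sublevel s x t.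
have law_cdf (S : probability R R) :
    law_at (score_fun s) x S `]-oo, t]%classic = S `[a, b]%classic.
  by rewrite -sublevel; congr (S _); apply/seteqP; split=> y /=; rewrite in_itv.
by rewrite !law_cdf; exact: itvcc_gap_le_KS.
Qed.

Theorem mainTheorem4 (R : realType)
    (d : measure_display) (Omega : measurableType d) (P : probability Omega R)
    (d' : measure_display) (T : measurableType d')
    (X : {RV P >-> T}) (Y : {RV P >-> R})
    (k : R.-pker T ~> R)
    (hk : regular_conditional_distribution X Y k)
    (s : score T R) (x : T) (Pphi : probability R R) :
  KS (law_at (score_fun s) x (kernel_at k x)) (marginal_law (score_fun s) X Y)
    <= 2 * KS (kernel_at k x) Pphi
       + KS (law_at (score_fun s) x Pphi) (marginal_law (score_fun s) X Y).
Proof.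
(* The score law under the model is the intermediate point; its distance to the marginal law then
   cancels from both sides. *)
apply: le_trans (KS_triangle (law_at (score_fun s) x Pphi) _ _) _.
by rewrite lerD2r; exact: KS_law_at_le.
Qed.
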